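(* There are $n$ coins that look the same but have different weights. There are only three possibilities $w_1<w_2<w_3$ for their weights, and exactly one coin has the middle weight $w_2$. The balance scale allows any number of coins on each pan. Then the problem of finding the only coin of the middle weight can be solved in $$\left\lceil \frac n2\right\rceil+\lceil \log_3 n\rceil$$ weighings.
   Context: The assignment of the weights $w_1<w_2<w_3$ to the coins is unknown, subject to the stated constraints, and the numerical values of the weights are unknown. A weighing on the balance scale compares two disjoint sets of coins, one on each pan, and reports whether the total weights are equal, the left pan is lighter, or the left pan is heavier. Each weighing may depend on the outcomes of the previous ones. The problem is solved in $m$ weighings if there is a strategy that always uses at most $m$ weighings and whose outcomes determine which coin has the middle weight $w_2$; it is not required to determine the weights of the other coins.
   Formalization: The case of n = 2 coins is excluded, because there the claim fails: coins of weights 1 and 2 could be w1, w2 or w2, w3, and no weighing tells these apart; all other n ≥ 1 are covered, even if w1 or w3 does not occur. *)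

(* Defs.v *)
From HB Require Import structures.
From mathcomp Require Import all_boot all_order all_algebra.

Set Implicit Arguments.
Unset Strict Implicit.
Unset Printing Implicit Defensive.

Import Order.TTheory GRing.Theory Num.Theory.

Local Open Scope ring_scope.

Inductive outcome : Type := Balanced | LeftLighter | LeftHeavier.

(* The two pans need not hold the same number of coins. *)
Definition weigh (R : realFieldType) (n : nat) (w : 'I_n -> R)
    (l r : {set 'I_n}) : outcome :=
  let wl := \sum_(i in l) w i in
  let wr := \sum_(i in r) w i in
  if wl == wr then Balanced
  else if wl < wr then LeftLighter else LeftHeavier.

(* Adaptive strategies are decision trees: the subtree that follows a weighing
   is chosen by its outcome alone, never by the weights themselves. *)
Inductive strategy (n : nat) : Type :=
| Answer (i : 'I_n)
| Weigh (l r : {set 'I_n}) (disj_lr : [disjoint l & r])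
    (next : outcome -> strategy n).

Fixpoint max_weighings (n : nat) (s : strategy n) : nat :=
  match s with
  | Answer _ => 0%N
  | Weigh _ _ _ next =>
      (maxn (max_weighings (next Balanced))
         (maxn (max_weighings (next LeftLighter))
            (max_weighings (next LeftHeavier)))).+1
  end.

Fixpoint run (R : realFieldType) (n : nat) (w : 'I_n -> R) (s : strategy n) :
    'I_n :=
  match s with
  | Answer i => i
  | Weigh l r _ next => run w (next (weigh w l r))
  end.

(* The extreme weights w1 and w3 are possible values: either may be absent. *)
Definition admissible (R : realFieldType) (n : nat) (w1 w2 w3 : R)
    (w : 'I_n -> R) : Prop :=
  [/\ w1 < w2, w2 < w3,
      forall i, [\/ w i = w1, w i = w2 | w i = w3]
    & #|[set i | w i == w2]| = 1%N].

(* The strategy is fixed before the values w1, w2, w3 and the assignment w. *)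
Definition solvable_in (R : realFieldType) (n m : nat) : Prop :=
  exists s : strategy n,
    (max_weighings s <= m)%N /\
    forall (w1 w2 w3 : R) (w : 'I_n -> R),
      admissible w1 w2 w3 w -> w (run w s) = w2.

(* Main.v *)
(* Compare the coins in disjoint pairs, putting the lighter coin of each
   unequal pair in A and the heavier one in B; the coins of an equal pair are
   not the middle coin. Since w3 never lands in A and w1 never lands in B, all
   of A weighs w1 and all of B weighs w3, except for the middle coin. The middle
   coin is thus a counterfeit of known sign, too heavy if it lies in A and too
   light if it lies in B, and a ternary search finds it in ceil(log_3 n)
   weighings. The ternary search only fails for A and B singletons, for lack of
   a reference coin; then one more coin c is compared with the coin of A and
   joins A or B. The same comparison classifies the unpaired coin when n is odd.
*)
Require Import Defs.
From mathcomp Require Import all_boot all_order all_algebra.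
From mathcomp Require Import zify lra.

Set Implicit Arguments.
Unset Strict Implicit.
Unset Printing Implicit Defensive.

Import Order.TTheory GRing.Theory Num.Theory.

Local Open Scope ring_scope.

(** * Strategies relative to the information gathered so far *)

(** The relation [W] records what earlier weighings have revealed. The strategy may exploit [W], but
    it is still chosen before the weights. *)
Definition solves (R : realFieldType) (n m : nat)
    (W : R -> R -> R -> ('I_n -> R) -> Prop) : Prop :=
  exists s : strategy n, (max_weighings s <= m)%N /\
    forall w1 w2 w3 w, admissible w1 w2 w3 w -> W w1 w2 w3 w ->
      w (run w s) = w2.

Lemma solves_sub (R : realFieldType) (n m : nat)
    (W W' : R -> R -> R -> ('I_n -> R) -> Prop) :
  (forall w1 w2 w3 w, admissible w1 w2 w3 w -> W w1 w2 w3 w -> W' w1 w2 w3 w) ->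
  solves m W' -> solves m W.
Proof.
move=> sub [s [sm sP]]; exists s; split=> // w1 w2 w3 w aw.
by move=> /(sub _ _ _ _ aw)/sP; apply.
Qed.

Lemma solves_answer (R : realFieldType) (n m : nat) (i : 'I_n)
    (W : R -> R -> R -> ('I_n -> R) -> Prop) :
  (forall w1 w2 w3 w, admissible w1 w2 w3 w -> W w1 w2 w3 w -> w i = w2) ->
  solves m W.
Proof. by move=> WP; exists (Answer i). Qed.

Lemma solves_weigh (R : realFieldType) (n m : nat) (l r : {set 'I_n})
    (W : R -> R -> R -> ('I_n -> R) -> Prop) :
  [disjoint l & r] ->
  (forall o, solves m (fun w1 w2 w3 w => W w1 w2 w3 w /\ weigh w l r = o)) ->
  solves m.+1 W.
Proof.
move=> lr next.
have [sb [mb sbP]] := next Balanced.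
have [sl [ml slP]] := next LeftLighter.
have [sh [mh shP]] := next LeftHeavier.
exists (Weigh lr (fun o => match o with
  Balanced => sb | LeftLighter => sl | LeftHeavier => sh end)); split=> /=.
  by rewrite ltnS !geq_max mb ml mh.
move=> w1 w2 w3 w aw Ww; case E: (weigh w l r).
- exact: sbP aw _.
- exact: slP aw _.
- exact: shP aw _.
Qed.

Lemma admissible_inj (R : realFieldType) (n : nat) (w1 w2 w3 : R)
    (w : 'I_n -> R) (i j : 'I_n) :
  admissible w1 w2 w3 w -> w i = w2 -> w j = w2 -> i = j.
Proof.
case=> _ _ _ /eqP/cards1P[k kP] wi wj.
have: i \in [set i | w i == w2] by rewrite inE wi.
have: j \in [set i | w i == w2] by rewrite inE wj.
by rewrite kP !inE => /eqP-> /eqP->.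
Qed.

Lemma admissible_ex (R : realFieldType) (n : nat) (w1 w2 w3 : R)
    (w : 'I_n -> R) :
  admissible w1 w2 w3 w -> exists i, w i = w2.
Proof.
case=> _ _ _ /eqP/cards1P[k kP]; exists k; apply/eqP.
by have: k \in [set k] by [rewrite inE]; rewrite -kP inE.
Qed.

(** * Splitting the candidates among the three outcomes *)

Lemma ex_disjoint_subsets (T : finType) (A : {set T}) (k : nat) :
  (k.*2 <= #|A|)%N ->
  exists L R : {set T},
    [/\ L \subset A, R \subset A, [disjoint L & R], #|L| = k & #|R| = k].
Proof.
have sub (B : {set T}) : (k <= #|B|)%N ->
    exists2 C : {set T}, C \subset B & #|C| = k.
  rewrite -bin_gt0 -cards_draws card_gt0 => /set0Pn[C].
  by rewrite inE => /andP[CB /eqP Ck]; exists C.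
move=> kA; have [|L LA Lk] := sub A; first by lia.
have [|S SA Sk] := sub (A :\: L); first by rewrite cardsDS // Lk; lia.
exists L, S; split=> //; first exact: subset_trans SA (subsetDl _ _).
by have := SA; rewrite subsetD disjoint_sym => /andP[].
Qed.

(** Here [s] is the least [x + y] that leaves at most [t] candidates off the scale. Halving [p] and
    [q] separately loses a pair only when both are odd; [s] still fits then if [t] is at least 2,
    while [t = 1] forces [p = q = 1]. *)
Lemma ex_halves (p q t : nat) :
  ~~ [&& t == 1, p == 1 & q == 1]%N -> (0 < t)%N -> (p + q <= 3 * t)%N ->
  exists x y, [/\ x.*2 <= p, y.*2 <= q, x + y <= t & p + q <= t + (x + y).*2]%N.
Proof.
move=> Nexc t_gt0 pq; pose s := uphalf (p + q - t).
by exists (minn s p./2), (s - p./2)%N; rewrite /s; split; lia.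
Qed.

(** [LA] and [LB] are meant for the left pan, [RA] and [RB] for the right one. The crossed counts
    reflect the opposite signs: a middle coin in [LA] or in [RB] makes the left pan heavier. The
    pans draw on [A] and [B] rather than on the candidates [P] and [Q], so that reference coins are
    available. *)
Lemma ex_ternary_split (T : finType) (A B P Q : {set T}) (t : nat) :
  P \subset A -> Q \subset B -> (1 < #|A|)%N || (1 < #|B|)%N ->
  (0 < t)%N -> (#|P| + #|Q| <= 3 * t)%N ->
  exists LA RA LB RB : {set T},
  [/\ [/\ LA \subset A, RA \subset A, [disjoint LA & RA] & #|LA| = #|RA|],
      [/\ LB \subset B, RB \subset B, [disjoint LB & RB] & #|LB| = #|RB|],
      (#|P :&: LA| + #|Q :&: RB| <= t)%N,
      (#|P :&: RA| + #|Q :&: LB| <= t)%N &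
      (#|P :\: (LA :|: RA)| + #|Q :\: (LB :|: RB)| <= t)%N].
Proof.
move=> PA QB AB t_gt0 PQ.
have [/and3P[/eqP t1 p1 q1] | Nexc] :=
  boolP [&& t == 1, #|P| == 1 & #|Q| == 1]%N; last first.
  have [x [y [xP yQ xy PQxy]]] := @ex_halves _ _ _ Nexc t_gt0 PQ.
  have [LA [RA [LAP RAP dA cLA cRA]]] := @ex_disjoint_subsets _ _ _ xP.
  have [LB [RB [LBQ RBQ dB cLB cRB]]] := @ex_disjoint_subsets _ _ _ yQ.
  exists LA, RA, LB, RB; split.
  - by rewrite cLA cRA; split=> //; apply: subset_trans PA.
  - by rewrite cLB cRB; split=> //; apply: subset_trans QB.
  - by rewrite (setIidPr LAP) (setIidPr RBQ) cLA cRB.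
  - by rewrite (setIidPr RAP) (setIidPr LBQ) cRA cLB.
  rewrite !cardsDS ?subUset ?LAP ?RAP ?LBQ ?RBQ // !cardsU !disjoint_setI0 //.
  rewrite !cards0 cLA cRA cLB cRB.
  by move: {PQ} (#|P|) (#|Q|) xP yQ PQxy => p q; lia.
(* No split inside P and Q here: a coin outside the candidates serves as a
   reference. *)
have ref x (C : {set T}) : x \in C -> (1 < #|C|)%N ->
    exists2 y, y \in C & y != x.
  rewrite (cardsD1 x) => -> /card_gt0P[y].
  by rewrite !inE => /andP[yx yC]; exists y.
have /cards1P[p Pp] := p1; have /cards1P[q Qq] := q1.
rewrite {}t1 {}Pp {}Qq !sub1set {p1 q1 PQ} in PA QB *.
have I1 (x y : T) : y != x -> [set x] :&: [set y] = set0.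
  by move=> yx; apply/disjoint_setI0; rewrite disjoints1 inE eq_sym.
have D1 (x y : T) : [set x] :\: [set x; y] = set0.
  by apply/eqP; rewrite setD_eq0 sub1set !inE eqxx.
case/orP: AB => [A1|B1].
  have [a aA ap] := ref _ _ PA A1.
  exists [set p], [set a], set0, set0; rewrite !sub1set !sub0set !cards1.
  rewrite !setI0 !setU0 !setD0 !setIid !cards0 !cards1 I1 // D1 cards0.
  split=> //; split=> //.
  - by rewrite disjoints1 inE eq_sym.
  - by rewrite -setI_eq0 setI0.
have [b bB bq] := ref _ _ QB B1.
exists set0, set0, [set q], [set b]; rewrite !sub1set !sub0set !cards1.
rewrite !setI0 !setU0 !setD0 !setIid !cards0 !cards1 I1 // D1 cards0.
split=> //; split=> //.
- by rewrite -setI_eq0 setI0.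
- by rewrite disjoints1 inE eq_sym.
Qed.

(** * Ternary search for a counterfeit of known sign *)

(** The candidates [P] and [Q] shrink during the search, while [A] and [B] stay fixed as the supply
    of coins of known weight. *)
Definition located (R : realFieldType) (n : nat) (A B P Q : {set 'I_n})
    (w1 w2 w3 : R) (w : 'I_n -> R) : Prop :=
  exists i, [/\ w i = w2, i \in P :|: Q,
    forall j, j \in A -> j != i -> w j = w1 &
    forall j, j \in B -> j != i -> w j = w3].

Lemma sum_but_one (R : realFieldType) (I : finType) (S : {set I}) (i : I)
    (u v : R) (w : I -> R) :
  w i = v -> (forall j, j \in S -> j != i -> w j = u) ->
  \sum_(j in S) w j = u *+ #|S| + (if i \in S then v - u else 0).
Proof.
move=> wi wS; rewrite -sumr_const.
case: ifPn => [iS|iNS]; last first.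
  rewrite addr0; apply: eq_bigr => j jS; apply: wS => //.
  by apply: contraNneq iNS => <-.
rewrite (bigD1 i) //= (bigD1 i iS) /= wi addrAC [u + _]addrC subrK.
by congr (_ + _); apply: eq_bigr => j /andP[jS ji]; rewrite wS.
Qed.

(** By the equal cardinalities, the two pans would balance if [i] had the weight of its class. The
    outcome is therefore decided by the pan of [i] and by the sign of its deviation, [w2 - w1] in
    [A] or [w2 - w3] in [B]. *)
Lemma weigh_middle (R : realFieldType) (n : nat) (w1 w2 w3 : R)
    (w : 'I_n -> R) (i : 'I_n) (A B LA RA LB RB : {set 'I_n}) :
  w1 < w2 -> w2 < w3 -> w i = w2 ->
  (forall j, j \in A -> j != i -> w j = w1) ->
  (forall j, j \in B -> j != i -> w j = w3) ->
  [disjoint A & B] -> i \in A :|: B ->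
  [/\ LA \subset A, RA \subset A, [disjoint LA & RA] & #|LA| = #|RA|] ->
  [/\ LB \subset B, RB \subset B, [disjoint LB & RB] & #|LB| = #|RB|] ->
  weigh w (LA :|: LB) (RA :|: RB) =
    if i \in LA :|: RB then LeftHeavier
    else if i \in RA :|: LB then LeftLighter else Balanced.
Proof.
move=> w12 w23 wi wA wB dAB iAB [LAA RAA dA cA] [LBB RBB dB cB].
have sumE (X Y : {set 'I_n}) : X \subset A -> Y \subset B ->
  \sum_(j in X :|: Y) w j = w1 *+ #|X| + (if i \in X then w2 - w1 else 0) +
      (w3 *+ #|Y| + (if i \in Y then w2 - w3 else 0)).
  move=> XA YB; under eq_bigl do rewrite inE.
  rewrite bigU ?(disjointW XA YB) //=.
  congr (_ + _); apply: sum_but_one => // j.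
    by move/(subsetP XA); apply: wA.
  by move/(subsetP YB); apply: wB.
rewrite /weigh !sumE // {}cA {}cB !inE.
move: (_ *+ #|RA|) (_ *+ #|RB|) => c1 c3.
case/setUP: iAB => [iA|iB].
  have iB := disjointFr dAB iA.
  rewrite (contraFF (subsetP LBB i) iB) (contraFF (subsetP RBB i) iB).
  rewrite !addr0 !orbF.
  have [iLA|iLA] := boolP (i \in LA); first rewrite (disjointFr dA iLA).
    case: eqP => [?|_]; first by exfalso; lra.
    by case: ltP => [?|//]; exfalso; lra.
  have [iRA|iRA] := boolP (i \in RA); last by rewrite eqxx.
  case: eqP => [?|_]; first by exfalso; lra.
  by case: ltP => [//|?]; exfalso; lra.
have iA := disjointFl dAB iB.
rewrite (contraFF (subsetP LAA i) iA) (contraFF (subsetP RAA i) iA) !addr0 /=.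
have [iLB|iLB] := boolP (i \in LB); first rewrite (disjointFr dB iLB).
  case: eqP => [?|_]; first by exfalso; lra.
  by case: ltP => [//|?]; exfalso; lra.
have [iRB|iRB] := boolP (i \in RB); last by rewrite eqxx.
case: eqP => [?|_]; first by exfalso; lra.
by case: ltP => [?|//]; exfalso; lra.
Qed.

(** Each weighing divides the bound on the number of candidates by 3. Since [A] and [B] do not
    change in the induction, the requirement of a second coin in one of them survives even when [P]
    and [Q] become singletons. *)
Lemma solves_located (R : realFieldType) (n m : nat) (A B P Q : {set 'I_n}) :
  [disjoint A & B] -> P \subset A -> Q \subset B ->
  (1 < #|A|)%N || (1 < #|B|)%N -> (#|P| + #|Q| <= 3 ^ m)%N ->
  solves m (@located R n A B P Q).
Proof.
move=> dAB + + AB; elim: m P Q => [|m IH] P Q PA QB PQ.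
  (* An outcome may leave no candidate. No weights are compatible with it, so any coin will do as
     the answer. *)
  have [PQ0|[k kPQ]] := set_0Vmem (P :|: Q).
    have n_gt0 : (0 < n)%N.
      by have := max_card A; have := max_card B; rewrite card_ord; lia.
    apply: (@solves_answer _ _ _ (Ordinal n_gt0)) => w1 w2 w3 w _ [i []].
    by rewrite PQ0 inE.
  apply: (@solves_answer _ _ _ k) => w1 w2 w3 w _ [i [wi iPQ _ _]].
  suff -> : k = i by [].
  have: (#|P :|: Q| <= 1)%N by apply: leq_trans PQ; rewrite cardsU leq_subr.
  by move/card_le1P=> /(_ k kPQ) /(_ i); rewrite iPQ inE => /esym/eqP.
have T_gt0 : (0 < 3 ^ m)%N by rewrite expn_gt0.
rewrite expnS in PQ.
have [LA [RA [LB [RB [[LAA RAA dA cA] [LBB RBB dB cB] cH cL cE]]]]] :=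
  @ex_ternary_split _ A B P Q _ PA QB AB T_gt0 PQ.
pose rest o := match o with
  | Balanced => (P :\: (LA :|: RA), Q :\: (LB :|: RB))
  | LeftLighter => (P :&: RA, Q :&: LB)
  | LeftHeavier => (P :&: LA, Q :&: RB)
  end.
have dI (X Y : {set 'I_n}) : X \subset A -> Y \subset B -> [disjoint X & Y].
  by move=> XA YB; apply: disjointW XA YB dAB.
apply: (@solves_weigh _ _ _ (LA :|: LB) (RA :|: RB)).
  by rewrite -setI_eq0 setIUl !setIUr [LB :&: RA]setIC (disjoint_setI0 dA)
     (disjoint_setI0 dB) !(disjoint_setI0 (dI _ _ _ _)) ?setU0.
move=> o; apply: (@solves_sub _ _ _ _ (located A B (rest o).1 (rest o).2)).
  move=> w1 w2 w3 w aw [[i [wi iPQ wA wB]] <-]; exists i; split=> //.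
  have iAB : i \in A :|: B by apply: (subsetP (setUSS PA QB)).
  have [w12 w23 _ _] := aw.
  rewrite (weigh_middle w12 w23 wi wA wB dAB iAB) //.
  case/setUP: iPQ => [iP|iQ].
    have iB := disjointFr dAB (subsetP PA i iP).
    have iLB := contraFF (subsetP LBB i) iB.
    have iRB := contraFF (subsetP RBB i) iB.
    rewrite !(in_setU i) iLB iRB !orbF.
    case: ifP => /= iLA; [|case: ifP => /= iRA];
      by rewrite !inE iP ?iLA ?iRA ?iLB ?iRB.
  have iA := disjointFl dAB (subsetP QB i iQ).
  have iLA := contraFF (subsetP LAA i) iA.
  have iRA := contraFF (subsetP RAA i) iA.
  rewrite !(in_setU i) iLA iRA.
  case: ifP => /= iRB; [|case: ifP => /= iLB];
    by rewrite !inE iQ ?iLA ?iRA ?iLB ?iRB ?orbT.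
apply: IH; case: o => //=.
all: by rewrite ?(subset_trans (subsetDl _ _)) ?(subset_trans (subsetIl _ _)).
Qed.

(** * Classifying the coins by comparisons in pairs *)

(* [U] holds the coins not yet weighed; the coins outside the three sets were in
   equal pairs. *)
Definition split_coins (R : realFieldType) (n : nat) (A B U : {set 'I_n})
    (w1 w2 w3 : R) (w : 'I_n -> R) : Prop :=
  [/\ forall j, j \in A -> w j <> w3, forall j, j \in B -> w j <> w1 &
      forall j, w j = w2 -> j \in A :|: B :|: U].

(** By uniqueness every coin but the middle one avoids [w2]; those of [A] also avoid [w3] and those
    of [B] avoid [w1], which leaves a single value for each class. *)
Lemma solves_split (R : realFieldType) (n m : nat) (A B : {set 'I_n}) :
  [disjoint A & B] -> (1 < #|A|)%N || (1 < #|B|)%N ->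
  (#|A| + #|B| <= 3 ^ m)%N ->
  solves m (@split_coins R n A B set0).
Proof.
move=> dAB AB cAB.
apply: solves_sub (solves_located R dAB (subxx A) (subxx B) AB cAB).
move=> w1 w2 w3 w aw [wA wB wU]; have [i wi] := admissible_ex aw.
have not_mid j : j != i -> w j <> w2.
  by move=> /eqP ji wj; apply: ji; apply: admissible_inj aw wj wi.
have [_ _ val _] := aw.
exists i; split=> //; first by have := wU i wi; rewrite setU0.
  by move=> j /wA jA /not_mid jm; have [] := val j.
by move=> j /wB jB /not_mid jm; have [] := val j.
Qed.

Lemma weigh_set1 (R : realFieldType) (n : nat) (w : 'I_n -> R) (i j : 'I_n) :
  match weigh w [set i] [set j] with
  | Balanced => w i = w j
  | LeftLighter => w i < w j
  | LeftHeavier => w j < w i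
  end.
Proof. by rewrite /weigh !big_set1; case: ltgtP. Qed.

Lemma admissible_bounds (R : realFieldType) (n : nat) (w1 w2 w3 : R)
    (w : 'I_n -> R) (i : 'I_n) :
  admissible w1 w2 w3 w -> w1 <= w i <= w3.
Proof. by case=> w12 w23 val _; have [] := val i => ->; lra. Qed.

(** If [c] is not heavier than [a], it cannot weigh [w3] and joins [A]; otherwise it cannot weigh
    [w1] and joins [B]. The set [U] is [[set c]] for the unpaired coin and empty when [c] comes from
    an equal pair. The strict bound leaves room for [c] in the search. *)
Lemma solves_insert (R : realFieldType) (n m : nat) (A B U : {set 'I_n})
    (a c : 'I_n) :
  a \in A -> c \notin A :|: B -> U \subset [set c] ->
  [disjoint A & B] -> (0 < #|B|)%N -> (#|A| + #|B| < 3 ^ m)%N ->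
  solves m.+1 (@split_coins R n A B U).
Proof.
rewrite inE negb_or => aA /andP[cA cB] Uc dAB B0 cAB.
have ca : c != a by apply: contraNneq cA => ->.
apply: (@solves_weigh _ _ _ [set c] [set a]).
  by rewrite disjoints1 inE.
have dU1 (X Y : {set 'I_n}) :
    c \notin Y -> [disjoint X & Y] -> [disjoint c |: X & Y].
  move=> cY dXY.
  by rewrite -setI_eq0 setIUl (disjoint_setI0 dXY) setU0 setI_eq0 disjoints1.
have UcP j : j \in U -> j = c by move/(subsetP Uc); rewrite inE => /eqP.
have pA : solves m (fun w1 w2 w3 w =>
    @split_coins R n A B U w1 w2 w3 w /\ w c <= w a).
  apply: solves_sub (@solves_split R n m (c |: A) B _ _ _).
  - move=> w1 w2 w3 w aw [[wA wB wU] le_ca]; split=> //.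
      move=> j /setU1P[->|/wA//] wc3; apply: (wA a aA).
      by have := admissible_bounds a aw; lra.
    by move=> j /wU; rewrite !inE => /orP[/orP[]->|/UcP->]; rewrite ?eqxx ?orbT.
  - exact: dU1.
  - by rewrite cardsU1 cA (cardsD1 a) aA.
  - by rewrite cardsU1 cA addSn.
have pB : solves m (fun w1 w2 w3 w =>
    @split_coins R n A B U w1 w2 w3 w /\ w a < w c).
  apply: solves_sub (@solves_split R n m A (c |: B) _ _ _).
  - move=> w1 w2 w3 w aw [[wA wB wU] lt_ac]; split=> //.
      move=> j /setU1P[->|/wB//] wc1.
      by have := admissible_bounds a aw; lra.
    by move=> j /wU; rewrite !inE => /orP[/orP[]->|/UcP->]; rewrite ?eqxx ?orbT.
  - by rewrite disjoint_sym dU1 // disjoint_sym.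
  - by rewrite (cardsU1 c B) cB ltnS B0 orbT.
  - by rewrite cardsU1 cB addnS.
case; [apply: solves_sub pA | apply: solves_sub pA | apply: solves_sub pB].
all: move=> w1 w2 w3 w _ [sw wo]; split=> //.
all: have := weigh_set1 w c a; rewrite wo.
- by move=> ->.
- exact: ltW.
- by [].
Qed.

(** Strong induction on [k], which drops by two with each comparison; an unequal pair adds one coin
    to each of [A] and [B], so their sizes stay equal. The parity of [k] is carried along because,
    at [k = 0], it makes [n] even, hence at least 4 once [A] and [B] are nonempty. *)
Lemma solves_pairs (R : realFieldType) (n k : nat) (A B U : {set 'I_n}) :
  (0 < n)%N -> n <> 2%N -> [disjoint A & B] -> [disjoint A :|: B & U] ->
  #|A| = #|B| -> #|U| = k -> odd k = odd n ->
  solves (uphalf k + up_log 3 n) (@split_coins R n A B U).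
Proof.
move=> n_gt0 n2; have nm := @up_logP 3 n isT.
have [k2] := ubnP k; elim: k2 => // k2 IH in k A B U *.
rewrite ltnS => kk2 dAB dU cAB cU on.
have cABU : (#|A| + #|B| + #|U| <= n)%N.
  rewrite -[leqRHS]card_ord.
  move: (dAB) (dU); rewrite -(leq_card_setU A B).2 => /eqP<-.
  by rewrite -(leq_card_setU _ U).2 => /eqP<-; apply: max_card.
case: k => [|[|k]] in cU kk2 on *.
- have {cU}-> : U = set0 by apply/eqP; rewrite -cards_eq0 cU.
  have [A0|[|A1]] : #|A| = 0%N \/ #|A| = 1%N \/ (1 < #|A|)%N by lia.
  (* All three sets are empty, which leaves no place for the middle coin: the case is vacuous and
     the answer arbitrary. *)
  + apply: (@solves_answer _ _ _ (Ordinal n_gt0)) => w1 w2 w3 w aw [_ _ wU].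
    have [i /wU] := admissible_ex aw.
    have -> : A = set0 by apply/eqP; rewrite -cards_eq0 A0.
    have -> : B = set0 by apply/eqP; rewrite -cards_eq0 -cAB A0.
    by rewrite !inE.
  + (* n is even here, so at least 4: some equal pair supplies the extra coin,
       and the bound leaves a spare weighing. *)
    move=> A1; have n4 : (3 < n)%N by lia.
    have /card_gt0P[c] : (0 < #|~: (A :|: B)|)%N.
      rewrite cardsCs setCK card_ord subn_gt0.
      by move: dAB; rewrite -(leq_card_setU A B).2 => /eqP->; lia.
    rewrite inE => cAB'; have /card_gt0P[a aA] : (0 < #|A|)%N by rewrite A1.
    (* As [n] exceeds 3, [up_log 3 n] is at least 2. One of these weighings places [c], and at least
       one remains to search the resulting three coins. *)
    move: nm; case: (up_log 3 n) => [|[|m]] nm.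
    + by rewrite expn0 in nm; lia.
    + by rewrite expn1 in nm; lia.
    rewrite add0n; apply: (solves_insert _ aA cAB') => //; first exact: sub0set.
      by rewrite -cAB A1.
    by rewrite -cAB A1 expnS (leq_pmulr 3) // expn_gt0.
  rewrite add0n; apply: solves_split => //; rewrite ?A1 //.
  by rewrite (leq_trans _ nm) // (leq_trans _ cABU) // leq_addr.
- have /eqP/cards1P[c Uc] := cU.
  (* If [A] and [B] are empty, the last coin is the middle one. Otherwise comparing it with a coin
     of [A] takes the weighing that [uphalf] grants to an odd [k]. *)
  have [A0|A1] := posnP #|A|.
    apply: (@solves_answer _ _ _ c) => w1 w2 w3 w aw [_ _ wU].
    have [i wi] := admissible_ex aw; have := wU i wi.
    have -> : A = set0 by apply/eqP; rewrite -cards_eq0 A0.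
    have -> : B = set0 by apply/eqP; rewrite -cards_eq0 -cAB A0.
    by rewrite !inE Uc inE => /eqP <-.
  have /card_gt0P[a aA] := A1.
  rewrite add1n.
  apply: (@solves_insert _ _ _ _ _ _ a c aA _ _ dAB _ _); rewrite -?cAB //.
    by rewrite Uc disjoint_sym disjoints1 in dU.
    by rewrite Uc.
  by rewrite (leq_trans _ nm) // (leq_trans _ cABU) // cU addn1 cAB.
have /card_gt1P[x [y [xU yU xy]]] : (1 < #|U|)%N by rewrite cU.
have cardU2 i j : i \in U -> j \in U -> i != j -> #|U :\: [set i; j]| = k.
  move=> iU jU ij.
  by rewrite cardsDS ?subUset ?sub1set ?iU // cards2 ij cU !subSS subn0.
(* Both unbalanced outcomes are instances of this, with [x] and [y] exchanged. From
   [w1 <= w i < w j <= w3], coin [i] is not of weight [w3] and coin [j] is not of weight [w1]. *)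
have lighter i j : i \in U -> j \in U -> i != j ->
    solves (uphalf k + up_log 3 n)
      (fun w1 w2 w3 w => @split_coins R n A B U w1 w2 w3 w /\ w i < w j).
  move=> iU jU ij; have iAB := disjointFl dU iU; have jAB := disjointFl dU jU.
  move: iAB jAB; rewrite !inE => /norP[iA iB] /norP[jA jB].
  apply: solves_sub (IH k (i |: A) (j |: B) (U :\: [set i; j]) _ _ _ _ _ _).
  - move=> w1 w2 w3 w aw [[wA wB wU] lt_ij].
    have /andP[_ j3] := admissible_bounds j aw.
    have /andP[i1 _] := admissible_bounds i aw.
    split=> [l /setU1P[->|/wA//] wi3|l /setU1P[->|/wB//] wj1|l /wU].
    + by have := lt_le_trans lt_ij j3; rewrite wi3 ltxx.
    + by have := le_lt_trans i1 lt_ij; rewrite wj1 ltxx.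
    by rewrite !inE; do 2!case: (l == _); case: (l \in A); case: (l \in B).
  - exact: ltnW.
  - rewrite -setI_eq0 -subset0; apply/subsetP=> l; rewrite !inE.
    case/andP=> /predU1P[->|lA] /predU1P[lj|lB].
    + by rewrite lj eqxx in ij.
    + by rewrite lB in iB.
    + by rewrite -lj lA in jA.
    + by rewrite (disjointFr dAB lA) in lB.
  - rewrite -setI_eq0 -subset0; apply/subsetP=> l; rewrite !inE.
    have := disjointFl dU (x := l); rewrite !inE.
    by do 2!case: (l == _); case: (l \in U); rewrite ?andbF //= => ->.
  - by rewrite !cardsU1 iA jB cAB.
  - exact: cardU2.
  - by rewrite -on /= negbK.
rewrite /= addSn; apply: (@solves_weigh _ _ _ [set x] [set y]).
  by rewrite disjoints1 inE.
case.
- apply: solves_sub (IH k A B (U :\: [set x; y]) _ _ _ _ _ _) => //.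
  + move=> w1 w2 w3 w aw [[wA wB wU] wo].
    have := weigh_set1 w x y; rewrite wo => wxy.
    split=> // l wl.
    have := wU l wl; rewrite !inE => /orP[->//|lU].
    rewrite lU andbT; apply/orP; right; apply/norP; split.
      apply: contraNneq xy => lx; apply/eqP.
      by apply: admissible_inj aw _ _; rewrite -?wxy -lx.
    apply: contraNneq xy => ly; apply/eqP.
    by apply: admissible_inj aw _ _; rewrite ?wxy -ly.
  + exact: ltnW.
  + by apply: disjointWr dU; apply: subsetDl.
  + exact: cardU2.
  + by rewrite -on /= negbK.
- apply: solves_sub (lighter x y xU yU xy) => w1 w2 w3 w _ [sw wo].
  by split=> //; have := weigh_set1 w x y; rewrite wo.
apply: solves_sub (lighter y x yU xU _); last by rewrite eq_sym.
move=> w1 w2 w3 w _ [sw wo].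
by split=> //; have := weigh_set1 w x y; rewrite wo.
Qed.

(* For n = 2 the weights (1, 2) fit both (w1, w2, w3) = (1, 2, 3) and
   (w1, w2, w3) = (0, 1, 2), so the middle coin cannot be identified. *)
Theorem theorem6p1 (R : realFieldType) (n : nat) (n_gt0 : (0 < n)%N)
    (n_neq2 : n <> 2%N) :
  solvable_in R n (uphalf n + up_log 3 n)%N.
Proof.
have [|||||s [sm sP]] := @solves_pairs R n n set0 set0 setT n_gt0 n_neq2.
- by rewrite -setI_eq0 setI0.
- by rewrite -setI_eq0 setU0 set0I.
- by [].
- by rewrite cardsT card_ord.
- by [].
exists s; split=> // w1 w2 w3 w aw; apply: (sP _ _ _ _ aw).
by split=> j; rewrite !inE // orbT.
Qed.
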